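(* Fix a positive integer $n$. If $n$ is even, let $A$ be one of the numbers $2\sin(j\pi/n)$ with $j\in\{0,1,2,\dots,(n-2)/2\}$. If $n$ is odd, let $A$ be one of the numbers $2\sin((2j+1)\pi/(2n))$ with $j\in\{0,1,2,\dots,(n-3)/2\}$. Then every point on the curve parameterized by $Ae^{i\theta}+e^{-2i\theta}$ ($\theta\in\mathbb{R}$) is mapped, under $z\mapsto p_n(z)$, to a point of the standard deltoid. Also, $p_n$ maps every point of the standard deltoid to a point of the standard deltoid.
   Context: The standard deltoid is $\Delta=\{2e^{i\varphi}+e^{-2i\varphi}:\varphi\in\mathbb{R}\}\subset\mathbb{C}$, equivalently the set of $z$ with $z^2\bar z^2-4(z^3+\bar z^3)+18z\bar z-27=0$. Let $D$ be the set of points on or inside it, i.e. $D=\{z\in\mathbb{C}: z^2\bar z^2-4(z^3+\bar z^3)+18z\bar z-27\le 0\}$. For each $z\in D$ there is a unique multiset $\{z_1,z_2,z_3\}$ of complex numbers with $|z_1|=|z_2|=|z_3|=z_1z_2z_3=1$ and $z_1+z_2+z_3=z$ (namely the roots $t$ of $t^3-zt^2+\bar z t-1=0$). For an integer $n$, the function $p_n:D\to D$ is defined by $p_n(z)=z_1^n+z_2^n+z_3^n$. *)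

(* Defs.v *)
From HB Require Import structures.
From mathcomp Require Import all_boot all_order all_algebra.
From mathcomp Require Import complex ring.
From mathcomp Require Import boolp reals trigo.

Set Implicit Arguments.
Unset Strict Implicit.
Unset Printing Implicit Defensive.

Import Order.TTheory GRing.Theory Num.Theory.
Local Open Scope ring_scope.
Local Open Scope complex_scope.

(* The notation _^* is ambiguous once complex_scope is open, so conjugation is
   written Num.conj throughout. *)

Definition deltoid_poly (C : numClosedFieldType) (z : C) : C :=
  z ^+ 2 * Num.conj z ^+ 2 - 4 * (z ^+ 3 + Num.conj z ^+ 3)
  + 18 * (z * Num.conj z) - 27.

(* For C = R[i], the order satisfies x <= 0 iff x is real and nonpositive, and
   deltoid_poly z is always real. *)
Definition deltoid_disk (C : numClosedFieldType) : Type :=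
  {z : C | deltoid_poly z <= 0}.

(* A multiset {z_1, z_2, z_3} is represented by a triple; multisets are equal
   when the triples are equal up to perm_eq. *)
Definition unimodular_triple (C : numClosedFieldType) (z : C)
    (t : 3.-tuple C) : Prop :=
  [/\ {in t, forall w : C, `|w| = 1},
      \prod_(w <- t) w = 1 & \sum_(w <- t) w = z].

Lemma tuple3P (C : Type) (t : 3.-tuple C) :
  exists x y z : C, t = [tuple x; y; z].
Proof.
case: t => [[|x [|y [|z [|u s]]]] //= e].
by exists x, y, z; apply/val_inj.
Qed.

Lemma prod_XsubC3 (C : comNzRingType) (a b c : C) :
  ('X - a%:P) * (('X - b%:P) * ('X - c%:P)) =
  'X^3 - (a + b + c) *: 'X^2 + (a * b + b * c + a * c) *: 'X - (a * b * c)%:P.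
Proof. by rewrite -!mul_polyC !(polyCD, polyCM); ring. Qed.

Lemma deltoid_poly_disc (C : numClosedFieldType) (a b c : C) :
  a * b * c = 1 -> Num.conj (a + b + c) = a * b + b * c + a * c ->
  deltoid_poly (a + b + c) = ((a - b) * (b - c) * (c - a)) ^+ 2.
Proof.
move=> abc e; rewrite /deltoid_poly e.
have -> : ((a - b) * (b - c) * (c - a)) ^+ 2 =
  (a + b + c) ^+ 2 * (a * b + b * c + a * c) ^+ 2
  - 4 * ((a + b + c) ^+ 3 * (a * b * c) + (a * b + b * c + a * c) ^+ 3)
  + 18 * ((a + b + c) * (a * b + b * c + a * c)) * (a * b * c)
  - 27 * (a * b * c) ^+ 2 by ring.
by rewrite abc expr1n !mulr1.
Qed.

Lemma conj_unimodular (C : numClosedFieldType) (a : C) :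
  `|a| = 1 -> Num.conj a = a^-1.
Proof. by move=> a1; rewrite invC_norm a1 expr1n invr1 mul1r. Qed.

Lemma norm_of_conj (C : numClosedFieldType) (a : C) :
  a != 0 -> Num.conj a = a^-1 -> `|a| = 1.
Proof.
move=> a0 e; apply/eqP; rewrite -(@eqrXn2 _ 2) // expr1n normCK e.
by rewrite mulfV.
Qed.

Lemma e2_unimodular (C : numClosedFieldType) (a b c : C) :
  `|a| = 1 -> `|b| = 1 -> `|c| = 1 -> a * b * c = 1 ->
  Num.conj (a + b + c) = a * b + b * c + a * c.
Proof.
move=> a1 b1 c1 abc.
have a0 : a != 0 by rewrite -normr_eq0 a1 oner_neq0.
have b0 : b != 0 by rewrite -normr_eq0 b1 oner_neq0.
have c0 : c != 0 by rewrite -normr_eq0 c1 oner_neq0.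
rewrite !rmorphD /= !conj_unimodular //.
apply: (mulfI (mulf_neq0 (mulf_neq0 a0 b0) c0)).
by rewrite [in RHS]abc mul1r; field; rewrite a0 b0 c0.
Qed.

Lemma deltoid_poly_unimodular (C : numClosedFieldType) (z : C)
    (t : 3.-tuple C) : unimodular_triple z t -> deltoid_poly z <= 0.
Proof.
have [a [b [c ->]]] := tuple3P t => -[n1].
rewrite !big_cons !big_nil mulr1 addr0 mulrA addrA => abc <-.
have a1 : `|a| = 1 by apply: n1; rewrite !inE eqxx.
have b1 : `|b| = 1 by apply: n1; rewrite !inE eqxx orbT.
have c1 : `|c| = 1 by apply: n1; rewrite !inE eqxx !orbT.
have a0 : a != 0 by rewrite -normr_eq0 a1 oner_neq0.
have b0 : b != 0 by rewrite -normr_eq0 b1 oner_neq0.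
have c0 : c != 0 by rewrite -normr_eq0 c1 oner_neq0.
rewrite deltoid_poly_disc ?e2_unimodular //.
set V := (_ * _).
have VN : Num.conj V = - V.
  rewrite /V !(rmorphM, rmorphB) /= !conj_unimodular //.
  have h : (a * b * c) ^+ 2 != 0 by rewrite abc expr1n oner_neq0.
  apply: (mulfI h); rewrite [in RHS]abc expr1n mul1r.
  by field; rewrite a0 b0 c0.
have := mul_conjC_ge0 V; rewrite VN mulrN -expr2 oppr_ge0.
by [].
Qed.

Lemma unimodular_reciprocal (C : numClosedFieldType) (a b c : C) :
  a * b * c = 1 -> Num.conj a = b^-1 ->
  ((a - b) * (b - c) * (c - a)) ^+ 2 <= 0 -> `|a| = 1.
Proof.
move=> abc cab.
have : a * b * c != 0 by rewrite abc oner_neq0.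
rewrite !mulf_eq0 !negb_or => /andP[/andP[a0 b0] c0].
have cba : Num.conj b = a^-1.
  by rewrite -[b]invrK -cab rmorphV ?unitfE ?conjC_eq0 //= conjCK.
have ec : c = (a * b)^-1.
  by apply: (mulfI (mulf_neq0 a0 b0)); rewrite abc mulfV // mulf_neq0.
have cc : Num.conj c = c^-1.
  by rewrite {1}ec rmorphV ?unitfE ?mulf_neq0 //= rmorphM /= cab cba ec -invfM
     mulrC.
set V := (_ * _) => V0.
have VR : Num.conj V = V.
  rewrite /V !(rmorphM, rmorphB) /= cab cba cc.
  have h : (a * b * c) ^+ 2 != 0 by rewrite abc expr1n oner_neq0.
  apply: (mulfI h); rewrite [in RHS]abc expr1n mul1r.
  by field; rewrite a0 b0 c0.
have : V == 0.
  have := mul_conjC_ge0 V; rewrite VR -expr2 => V1.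
  by rewrite -sqrf_eq0 eq_le V0 V1.
rewrite /V !mulf_eq0 !subr_eq0 => /orP[/orP[]|] /eqP e.
- by apply: norm_of_conj => //; rewrite cab e.
- have b1 : `|b| = 1 by apply: norm_of_conj; rewrite // e.
  by rewrite -norm_conjC cab normfV b1 invr1.
- by apply: norm_of_conj => //; rewrite -e.
Qed.

Lemma unimodular_root (C : numClosedFieldType) (a b c : C) :
  a * b * c = 1 -> Num.conj (a + b + c) = a * b + b * c + a * c ->
  deltoid_poly (a + b + c) <= 0 -> `|a| = 1.
Proof.
move=> abc e d0.
have : a * b * c != 0 by rewrite abc oner_neq0.
rewrite !mulf_eq0 !negb_or => /andP[/andP[a0 b0] c0].
have ca0 : Num.conj a != 0 by rewrite conjC_eq0.
pose w := (Num.conj a)^-1.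
have wE : (w - a) * (w - b) * (w - c) = 0.
  have -> : (w - a) * (w - b) * (w - c) =
    w ^+ 3 - (a + b + c) * w ^+ 2 + (a * b + b * c + a * c) * w - a * b * c
    by ring.
  have e' : Num.conj (a * b + b * c + a * c) = a + b + c by rewrite -e conjCK.
  have -> : w ^+ 3 - (a + b + c) * w ^+ 2 + (a * b + b * c + a * c) * w
     - a * b * c = - Num.conj (a ^+ 3 - (a + b + c) * a ^+ 2
     + (a * b + b * c + a * c) * a - a * b * c) / Num.conj a ^+ 3.
    have cE (u v : C) : Num.conj (a ^+ 3 - u * a ^+ 2 + v * a - 1) =
        Num.conj a ^+ 3 - Num.conj u * Num.conj a ^+ 2
        + Num.conj v * Num.conj a - 1.
      by rewrite !(rmorphB, rmorphM, rmorphD, rmorphXn, rmorph1).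
    by rewrite abc cE e e' /w; field.
  have -> : a ^+ 3 - (a + b + c) * a ^+ 2
     + (a * b + b * c + a * c) * a - a * b * c = 0 by ring.
  by rewrite rmorph0 oppr0 mul0r.
rewrite deltoid_poly_disc // in d0.
move/eqP: wE; rewrite !mulf_eq0 !subr_eq0 => /orP[/orP[]|] /eqP wE.
- by apply: norm_of_conj; rewrite // -{2}wE invrK.
- by apply: (unimodular_reciprocal abc) d0; rewrite -wE invrK.
- apply: (@unimodular_reciprocal _ a c b); first by rewrite mulrAC.
    by rewrite -wE invrK.
  by move: d0; congr (_ <= _); ring.
Qed.

Lemma unimodular_triple_exists (C : numClosedFieldType) (z : C) :
  deltoid_poly z <= 0 -> exists t : 3.-tuple C, unimodular_triple z t.
Proof.
move=> z0.
pose p : {poly C} := 'X^3 - z *: 'X^2 + Num.conj z *: 'X - 1%:P.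
have sq : (size (- (z *: 'X^2) + Num.conj z *: 'X - 1%:P)%R < 4)%N.
  rewrite (leq_ltn_trans (size_polyD _ _)) // size_polyN gtn_max; apply/andP.
  split; last by rewrite (leq_ltn_trans (size_polyC_leq1 _)).
  rewrite (leq_ltn_trans (size_polyD _ _)) // size_polyN gtn_max; apply/andP.
  by split; rewrite (leq_ltn_trans (size_scale_leq _ _)) // ?size_polyXn ?size_polyX.
have pE : p = 'X^3 + (- (z *: 'X^2) + Num.conj z *: 'X - 1%:P).
  by rewrite /p !addrA.
have sp : size p = 4%N by rewrite pE size_polyDl size_polyXn.
have lp : lead_coef p = 1.
  by rewrite pE lead_coefDl ?size_polyXn // lead_coefXn.
have [rs] := closed_field_poly_normal p; rewrite lp scale1r => prs.
have s3 : size rs = 3%N.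
  by have := size_prod_XsubC rs id; rewrite -prs sp => -[<-].
case: rs s3 prs => [|a [|b [|c [|d s]]]] //= _.
rewrite !big_cons big_nil mulr1 prod_XsubC3 => prs.
have /(congr1 (fun q : {poly C} => (q`_0, q`_1, q`_2))) := prs.
rewrite /p !(coefB, coefD, coefZ, coefXn, coefX, coefC) /=.
rewrite !(mulr0, mulr1, subr0, addr0, add0r, sub0r, oppr0) => /eqP.
rewrite !xpair_eqE => /andP[/andP[/eqP e0 /eqP e1] /eqP e2].
have abc : a * b * c = 1 by apply: oppr_inj.
have {e2}ez : z = a + b + c by apply: oppr_inj.
have ec : Num.conj (a + b + c) = a * b + b * c + a * c by rewrite -ez.
exists [tuple a; b; c]; split; last first.
- by rewrite !big_cons big_nil addr0 addrA -ez.
- by rewrite !big_cons big_nil mulr1 mulrA.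
rewrite ez in z0.
have a1 : `|a| = 1 by apply: (unimodular_root abc).
have b1 : `|b| = 1.
  apply: (@unimodular_root _ b c a); first by rewrite -abc; ring.
    by rewrite [b + c + a]addrC addrA ec; ring.
  by rewrite [b + c + a]addrC addrA.
have c1 : `|c| = 1.
  apply: (@unimodular_root _ c a b); first by rewrite -abc; ring.
    by rewrite -addrA [c + _]addrC ec; ring.
  by rewrite -addrA [c + _]addrC.
by move=> w; rewrite !inE => /or3P[] /eqP ->.
Qed.

Lemma unimodular_triple_prod (C : numClosedFieldType) (z : C)
    (t : 3.-tuple C) : unimodular_triple z t ->
  \prod_(w <- t) ('X - w%:P) = 'X^3 - z *: 'X^2 + Num.conj z *: 'X - 1%:P.
Proof.
have [a [b [c ->]]] := tuple3P t => -[n1].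
rewrite !big_cons !big_nil !mulr1 addr0 mulrA addrA => abc <-.
have a1 : `|a| = 1 by apply: n1; rewrite !inE eqxx.
have b1 : `|b| = 1 by apply: n1; rewrite !inE eqxx orbT.
have c1 : `|c| = 1 by apply: n1; rewrite !inE eqxx !orbT.
by rewrite prod_XsubC3 e2_unimodular // abc.
Qed.

Lemma unimodular_triple_uniq (C : numClosedFieldType) (z : C)
    (s t : 3.-tuple C) :
  unimodular_triple z s -> unimodular_triple z t -> perm_eq s t.
Proof.
move=> /unimodular_triple_prod es /unimodular_triple_prod et.
by apply: prod_XsubC_eq; rewrite es et.
Qed.

Definition deltoid_triple (C : numClosedFieldType) (z : deltoid_disk C) :
  3.-tuple C := sval (cid (unimodular_triple_exists (svalP z))).

Lemma deltoid_tripleP (C : numClosedFieldType) (z : deltoid_disk C) :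
  unimodular_triple (sval z) (deltoid_triple z).
Proof. exact: svalP (cid (unimodular_triple_exists (svalP z))). Qed.

Lemma power_sum_subproof (C : numClosedFieldType) (n : int)
    (z : deltoid_disk C) :
  deltoid_poly (\sum_(w <- deltoid_triple z) w ^ n) <= 0.
Proof.
have [n1 p1 _] := deltoid_tripleP z.
apply: (@deltoid_poly_unimodular _ _ [tuple of [seq w ^ n | w <- deltoid_triple z]]).
have norm_exprz (x : C) : `|x| = 1 -> `|x ^ n| = 1.
  by case: n => k h; rewrite /exprz ?normfV normrX h expr1n ?invr1.
have prodz (s : seq C) : \prod_(w <- s) w ^ n = (\prod_(w <- s) w) ^ n.
  elim: s => [|x s IHs]; first by rewrite !big_nil exp1rz.
  by rewrite !big_cons IHs expfzMl.
split=> /=.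
- by move=> _ /mapP[x xt ->]; apply: norm_exprz; apply: n1.
- by rewrite big_map prodz p1 exp1rz.
- by rewrite big_map.
Qed.

Definition power_sum (C : numClosedFieldType) (n : int) (z : deltoid_disk C) :
  deltoid_disk C :=
  exist _ (\sum_(w <- deltoid_triple z) w ^ n) (power_sum_subproof n z).

Lemma power_sumE (C : numClosedFieldType) (n : int) (z : deltoid_disk C)
    (t : 3.-tuple C) : unimodular_triple (sval z) t ->
  sval (power_sum n z) = \sum_(w <- t) w ^ n.
Proof.
move=> zt; apply: perm_big.
exact: unimodular_triple_uniq (deltoid_tripleP z) zt.
Qed.

Definition expi (R : realType) (t : R) : R[i] := cos t +i* sin t.

Definition hypotrochoid (R : realType) (A t : R) : R[i] :=
  A%:C * expi t + expi (- 2 * t).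

Definition standard_deltoid (R : realType) (z : R[i]) : Prop :=
  exists t : R, z = 2 * expi t + expi (- 2 * t).

(* The ranges 0 <= j <= (n-2)/2 and 0 <= j <= (n-3)/2 are written without
   subtraction, so that the second one is empty for n = 1. *)
Definition special_amplitude (R : realType) (n : nat) (A : R) : Prop :=
  if odd n then
    exists2 j : nat, (2 * j + 3 <= n)%N
      & A = 2 * sin ((2 * j + 1)%:R * pi / (2 * n)%:R)
  else
    exists2 j : nat, (2 * j + 2 <= n)%N & A = 2 * sin (j%:R * pi / n%:R).

(* Main.v *)
Require Import Defs.
From mathcomp Require Import all_boot all_order all_algebra.
From mathcomp Require Import complex.
From mathcomp Require Import boolp reals trigo.
From mathcomp Require Import ring zify.

(** A point [A e^{it} + e^{-2it}] with [A = 2 cos f] is the sum of the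
    unimodular numbers [e^{i(t+f)}], [e^{i(t-f)}] and [e^{-2it}], whose product
    is [1]; so it lies in the disk and these three numbers are its triple.
    Raising them to the power [n], the first two coincide exactly when
    [e^{2if}] is an [n]-th root of unity.  The image under [p_n] is then
    [2u + u^{-2}] with [u] unimodular, which is a point of the deltoid
    ([power_sum_hypotrochoid]).

    The amplitudes of the theorem are of this kind: for [A = 2 sin b]
    one takes [f = pi/2 - b], and [2 n f = n pi - 2 n b] is an integer multiple
    of [2 pi].  The deltoid itself is the case [f = 0]. *)

Import GRing.Theory Num.Theory.
Local Open Scope ring_scope.
Local Open Scope complex_scope.

Lemma expi0 (R : realType) : expi 0 = 1 :> R[i].
Proof. by rewrite /expi cos0 sin0. Qed.

Lemma expiD (R : realType) (x y : R) : expi (x + y) = expi x * expi y.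
Proof. by rewrite /expi cosD sinD; simpc; rewrite [sin x * _ + _]addrC. Qed.

Lemma expi_natmul (R : realType) (n : nat) (x : R) :
  expi (n%:R * x) = expi x ^+ n.
Proof.
elim: n => [|n IHn]; first by rewrite mul0r expi0 expr0.
by rewrite -natr1 mulrDl mul1r expiD IHn exprSr.
Qed.

Lemma expi_2pi_nat (R : realType) (m : nat) : expi (m%:R * (2 * pi)) = 1 :> R[i].
Proof.
by rewrite expi_natmul mulr_natl /expi cos2pi sin2pi expr1n.
Qed.

Lemma norm_expi (R : realType) (x : R) : `|expi x| = 1.
Proof. by rewrite normc_def /= cos2Dsin2 sqrtr1. Qed.

Lemma unimodular_triple_hypotrochoid (R : realType) (f t : R) :
  unimodular_triple (hypotrochoid (2 * cos f) t)
    [tuple expi (t + f); expi (t - f); expi (- 2 * t)].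
Proof.
split.
- by move=> w; rewrite !inE => /or3P[] /eqP ->; rewrite norm_expi.
- rewrite !big_cons big_nil mulr1 -!expiD -[RHS](expi0 R); congr expi; ring.
- rewrite !big_cons big_nil addr0 addrA /hypotrochoid !expiD -mulrDr.
  congr (_ + _); rewrite mulrC; congr (_ * _).
  (* [2 cos f = e^{if} + e^{-if}] *)
  rewrite /expi cosN sinN; simpc.
  by rewrite mulr_natl mulr2n.
Qed.

(** The condition on [f] says that the first two members [e^{i(t+f)}] and
    [e^{i(t-f)}] of the triple have the same [n]-th power. *)
Lemma power_sum_hypotrochoid (R : realType) (n : nat) (f t : R) :
  expi (n%:R * (2 * f)) = 1 ->
  exists2 z : deltoid_disk R[i], sval z = hypotrochoid (2 * cos f) t
    & standard_deltoid (sval (power_sum n%:Z z)).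
Proof.
move=> nf; have zT := unimodular_triple_hypotrochoid R f t.
pose z : deltoid_disk R[i] :=
  exist (fun w => is_true (deltoid_poly w <= 0)) _ (deltoid_poly_unimodular zT).
exists z => //; rewrite (@power_sumE _ _ z _ zT).
exists (n%:R * (t - f)).
rewrite !big_cons big_nil addr0 -!exprnP -!expi_natmul.
have -> : n%:R * (t + f) = n%:R * (t - f) + n%:R * (2 * f) by ring.
have -> : - 2 * (n%:R * (t - f)) = n%:R * (- 2 * t) + n%:R * (2 * f) by ring.
rewrite !expiD nf !mulr1 addrA; congr (_ + _).
by rewrite [RHS]mulr_natl mulr2n.
Qed.

(** With [f = pi/2 - b], the angle [2 n f] is [n pi - (2j+1) pi] for odd [n] and
    [n pi - 2j pi] for even [n]; in both cases the parity of [n] makes it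
    [n./2 - j] full turns.  The range of [j] makes this difference nonnegative,
    so that a natural number of turns suffices. *)
Lemma special_amplitude_cos (R : realType) (n : nat) (A : R) :
  (0 < n)%N -> special_amplitude n A ->
  exists2 f : R, A = 2 * cos f & expi (n%:R * (2 * f)) = 1.
Proof.
move=> n_gt0.
have n0 : n%:R != 0 :> R by rewrite pnatr_eq0 -lt0n.
rewrite /special_amplitude; case: ifPn => on [j jn ->].
  exists (pi / 2 - (2 * j + 1)%:R * pi / (2 * n)%:R).
    by rewrite cosB cos_pihalf sin_pihalf mul0r add0r mul1r.
  rewrite -[RHS](expi_2pi_nat R (n./2 - j)); congr expi.
  have nE : n = (2 * (n./2 - j) + (2 * j + 1))%N by lia.
  have nER : n%:R = 2 * (n./2 - j)%:R + (2 * j + 1)%:R :> R.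
    by rewrite {1}nE natrD natrM.
  transitivity (n%:R * pi - (2 * j + 1)%:R * pi : R).
    by rewrite natrM; field.
  by rewrite nER; ring.
exists (pi / 2 - j%:R * pi / n%:R).
  by rewrite cosB cos_pihalf sin_pihalf mul0r add0r mul1r.
rewrite -[RHS](expi_2pi_nat R (n./2 - j)); congr expi.
have nE : n = (2 * (n./2 - j) + 2 * j)%N by lia.
have nER : n%:R = 2 * (n./2 - j)%:R + 2 * j%:R :> R.
  by rewrite {1}nE natrD !natrM.
transitivity (n%:R * pi - 2 * j%:R * pi : R); first by field.
by rewrite nER; ring.
Qed.

Theorem theorem5p5 (R : realType) (n : nat) (hn : (0 < n)%N) :
  (forall A : R, special_amplitude n A ->
     forall t : R, exists2 z : deltoid_disk R[i],
       sval z = hypotrochoid A t & standard_deltoid (sval (power_sum n%:Z z)))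
  /\
  (forall w : R[i], standard_deltoid w ->
     exists2 z : deltoid_disk R[i],
       sval z = w & standard_deltoid (sval (power_sum n%:Z z))).
Proof.
split=> [A hA t|_ [t ->]].
  have [f -> nf] := special_amplitude_cos R n A hn hA.
  exact: power_sum_hypotrochoid.
have -> : 2 * expi t + expi (- 2 * t) = hypotrochoid (2 * cos 0) t.
  by rewrite /hypotrochoid cos0 mulr1 rmorph_nat.
by apply: power_sum_hypotrochoid; rewrite !mulr0 expi0.
Qed.
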